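(* The P-algorithm, based on the Gaussian model with estimated parameters, is strongly homogeneous. That is, if $\phi(x)=a f(x)+b$ with constants $a,b$, and $x_i$, $v_i$, $i=1,2,\ldots$, denote the sequences of points generated by the P-algorithm applied to $f$ and to $\phi$ respectively, then $x_i=v_i$, $i=1,2,\ldots$.
   Context: **Problem.** Consider the minimization of a (possibly multimodal) objective function over a hyper-rectangle $A\subseteq\mathbb{R}^d$. **Strong homogeneity.** Consider two objective functions $f(x)$ and $\phi(x)$, $x\in A$, differing only in the scales of function values, i.e. $\phi(x)=af(x)+b$. Here $f$ is defined using the traditional finite arithmetic, and $a,b$ are constants that can assume not only finite but also infinite and infinitesimal values, expressed by numerals of Sergeyev's arithmetic of infinity (a numeral system in which finite, infinite and infinitesimal numbers can be written and computed with). Let $x_i$ and $v_i$, $i=1,2,\ldots$, be the sequences of points generated by an algorithm applied to $f$ and to $\phi$ respectively. The algorithm is called strongly homogeneous if it generates identical sequences, $x_i=v_i$, $i=1,2,\ldots$. For the analysis it is assumed that the first $n$ values of both functions were computed at the same points $x_1,\ldots,x_n$, and the equality in question is that of the next points, $x_{n+1}=v_{n+1}$. **Gaussian model.** The statistical model of the objective function is a Gaussian stochastic function $\xi(x)$ with mean value $\mu$, variance $\sigma^2$ and correlation function $\rho(\cdot,\cdot)$. Given the function values $y_i=f(x_i)$, $i=1,\ldots,n$, the conditional mean and conditional variance of $\xi(x)$ with respect to $\xi(x_i)=y_i$, $i=1,\ldots,n$, are $$m_n(x|x_i,y_i)=\mu+(y_1-\mu,\ldots,y_n-\mu)\Sigma^{-1}\Upsilon^T,\qquad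 s_n^2(x|x_i,y_i)=\sigma^2(1-\Upsilon\Sigma^{-1}\Upsilon^T),$$ where $\Upsilon=(\rho(x_1,x),\ldots,\rho(x_n,x))$ and $\Sigma=(\rho(x_i,x_j))_{i,j=1}^n$. **Estimated parameters.** The parameters $\mu,\sigma^2$ are replaced by estimates obtained by the same method from the function values. The estimates from the data $(x_i,y_i=f(x_i))$, $i=1,\ldots,n$, are denoted $\bar\mu,\bar\sigma^2$, and those from $(x_i,z_i=\phi(x_i))$, $i=1,\ldots,n$, are denoted $\tilde\mu,\tilde\sigma^2$. It is assumed that $\tilde\mu=a\bar\mu+b$ and $\tilde\sigma^2=a^2\bar\sigma^2$. **P-algorithm.** The next function value is computed at the point of maximum probability to overpass the aspiration level: $$x_{n+1}=\arg\max_{x\in A}\mathbf{P}\{\xi(x)\le y_{on}\mid\xi(x_i)=y_i,\ i=1,\ldots,n\},$$ which, since $\xi(x)$ is Gaussian, is reduced to the maximization over $x\in A$ of $$\frac{y_{on}-m_n(x|x_i,y_i)}{s_n(x|x_i,y_i)}.$$ For $\phi$, the point $v_{n+1}$ is defined in the same way with $z_i$, $z_{on}$ in place of $y_i$, $y_{on}$. The aspiration levels are $y_{on}=\min_{i=1,\ldots,n}y_i-\varepsilon\bar\sigma$ for $f$ and $z_{on}=\min_{i=1,\ldots,n}z_i-\varepsilon\tilde\sigma$ for $\phi$, with the same constant $\varepsilon$.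
   Formalization: The constant a is assumed positive (it may be finite, infinite or infinitesimal): for a<0 the claim fails (f(x)=x and φ(x)=-x on [0,1] give different next points), and for a=0 the estimated variance is 0 and the criterion is undefined. *)

(* Defs.v *)
From mathcomp Require Import all_boot all_order all_algebra.
From mathcomp Require Import boolp classical_sets reals constructive_ereal.

Set Implicit Arguments.
Unset Strict Implicit.
Unset Printing Implicit Defensive.
Import Order.TTheory GRing.Theory Num.Theory.
Local Open Scope classical_set_scope.
Local Open Scope ring_scope.

(* Two number systems are used throughout: the finite numbers, R : realType,
   and the numbers in which values of objective functions are computed,
   K : rcfType, together with an embedding iota of R in K.  K may be
   non-Archimedean, in which case it has infinite and infinitesimal elements.
   A ring morphism from R to K is automatically injective and
   order-preserving, since the nonnegative elements of R are the squares.
   That K is real closed is used only to have square roots in it (standard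
   deviations).  Points of R^d are row vectors; n.+1 observation points are
   the rows of a matrix, and the corresponding values form a row vector. *)

Definition hyperrectangle (R : realType) (d : nat) (lo hi : 'rV[R]_d) :
    set 'rV[R]_d :=
  [set x | forall j, lo 0 j <= x 0 j <= hi 0 j].

Definition corr_mx (R : realType) (d : nat) (rho : 'rV[R]_d -> 'rV[R]_d -> R)
    (n : nat) (X : 'M[R]_(n, d)) : 'M[R]_n :=
  \matrix_(i, j) rho (row i X) (row j X).

Definition corr_row (R : realType) (d : nat) (rho : 'rV[R]_d -> 'rV[R]_d -> R)
    (n : nat) (X : 'M[R]_(n, d)) (x : 'rV[R]_d) : 'rV[R]_n :=
  \row_i rho (row i X) x.

Definition is_correlation (R : realType) (d : nat) (A : set 'rV[R]_d)
    (rho : 'rV[R]_d -> 'rV[R]_d -> R) : Prop :=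
  [/\ forall x y, A x -> A y -> rho x y = rho y x,
      forall x, A x -> rho x x = 1 &
      forall (n : nat) (X : 'M[R]_(n, d)) (c : 'rV[R]_n),
        (forall i, A (row i X)) -> 0 <= (c *m corr_mx rho X *m c^T) 0 0].

(* The data of a P-algorithm: the correlation function, the methods estimating
   mean and variance from observation points and values (the same method is
   applied to every objective function), and the constant eps of the
   aspiration level.  The tie-breaking rule only matters when the maximizer
   is not unique; it depends on the set of maximizers alone. *)
Record P_model (R : realType) (K : rcfType) (d : nat) := PModel {
  rho : 'rV[R]_d -> 'rV[R]_d -> R;
  mean_est : forall n : nat, 'M[R]_(n.+1, d) -> 'rV[K]_n.+1 -> K;
  var_est : forall n : nat, 'M[R]_(n.+1, d) -> 'rV[K]_n.+1 -> K;
  eps : K;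
  tie_break : set 'rV[R]_d -> 'rV[R]_d }.

(* When the correlation matrix is singular (e.g. repeated observation points)
   invmx returns its argument unchanged, and these formulas have no meaning as
   conditional moments. *)
Definition cond_mean (R : realType) (K : rcfType) (iota : {rmorphism R -> K})
    (d : nat) (rho : 'rV[R]_d -> 'rV[R]_d -> R) (mu : K)
    (n : nat) (X : 'M[R]_(n, d)) (y : 'rV[K]_n) (x : 'rV[R]_d) : K :=
  mu + ((y - const_mx mu) *m invmx (map_mx iota (corr_mx rho X))
        *m (map_mx iota (corr_row rho X x))^T) 0 0.

Definition cond_var (R : realType) (K : rcfType) (iota : {rmorphism R -> K})
    (d : nat) (rho : 'rV[R]_d -> 'rV[R]_d -> R) (s2 : K)
    (n : nat) (X : 'M[R]_(n, d)) (x : 'rV[R]_d) : K :=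
  s2 * (1 - (map_mx iota (corr_row rho X x)
             *m invmx (map_mx iota (corr_mx rho X))
             *m (map_mx iota (corr_row rho X x))^T) 0 0).

Definition aspiration (R : realType) (K : rcfType) (d : nat)
    (M : P_model R K d) (n : nat) (X : 'M[R]_(n.+1, d)) (y : 'rV[K]_n.+1) : K :=
  \big[Num.min/y 0 ord0]_(i < n.+1) y 0 i
    - eps M * Num.sqrt (var_est M X y).

(* (yo - m) / s, which is maximized in place of the probability that a Gaussian
   variable with mean m and standard deviation s is at most yo.  When s = 0
   (e.g. at the points already observed) that variable is the constant m, the
   probability is 1 or 0, and the ratio is accordingly read as +oo or -oo;
   the field convention (yo - m) / 0 = 0 would be wrong here. *)
Definition P_ratio (K : rcfType) (m s yo : K) : \bar K :=
  if s == 0 then (if m <= yo then +oo%E else -oo%E) else ((yo - m) / s)%:E.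

Definition P_criterion (R : realType) (K : rcfType) (iota : {rmorphism R -> K})
    (d : nat) (M : P_model R K d)
    (n : nat) (X : 'M[R]_(n.+1, d)) (y : 'rV[K]_n.+1) (x : 'rV[R]_d) : \bar K :=
  P_ratio (cond_mean iota (rho M) (mean_est M X y) X y x)
          (Num.sqrt (cond_var iota (rho M) (var_est M X y) X x))
          (aspiration M X y).

Definition argmax (T : Type) (K : rcfType) (A : set T) (g : T -> \bar K) :
    set T :=
  [set x | A x /\ forall z, A z -> (g z <= g x)%E].

Definition first_points (R : realType) (d : nat) (x : nat -> 'rV[R]_d)
    (n : nat) : 'M[R]_(n, d) :=
  \matrix_(i < n) x i.

Definition first_values (R : realType) (K : rcfType) (d : nat)
    (F : 'rV[R]_d -> K) (x : nat -> 'rV[R]_d) (n : nat) : 'rV[K]_n :=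
  \row_(i < n) F (x i).

(* x is a sequence of points generated by the P-algorithm applied to the
   objective function F on A.  Indices start at 0: the points x 0, ..., x n0
   are the initial design, and x n.+1 is determined by the n.+1 observations at
   x 0, ..., x n.  The sequence exists only if the maxima are attained. *)
Definition P_generated (R : realType) (K : rcfType) (iota : {rmorphism R -> K})
    (d : nat) (A : set 'rV[R]_d) (M : P_model R K d) (n0 : nat)
    (F : 'rV[R]_d -> K) (x : nat -> 'rV[R]_d) : Prop :=
  (forall i, (i <= n0)%N -> A (x i)) /\
  forall n, (n0 <= n)%N ->
    let S := argmax A (P_criterion iota M (first_points x n.+1)
                                          (first_values F x n.+1)) in
    S (x n.+1) /\ x n.+1 = tie_break M S.

(* Main.v *)
Require Import Defs.
From mathcomp Require Import all_boot all_order all_algebra.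
From mathcomp Require Import boolp classical_sets reals constructive_ereal.
Import Order.TTheory GRing.Theory Num.Theory.
Local Open Scope ring_scope.

(* Under an increasing affine change of the values, a level minus a mean and a
   standard deviation are both multiplied by a, so the ratio maximized by the
   P-algorithm does not change as a function of the candidate point; in
   particular the set of maximizers handed to the tie-breaking rule is the
   same. *)

(** The shift [b] cancels in the residuals, which are multiplied by [a], and the correction term is
    linear in them. The matrix [invmx] is only carried along, so the identity also covers a singular
    correlation matrix. *)
Lemma cond_mean_affine (R : realType) (K : rcfType)
    (iota : {rmorphism R -> K}) (d : nat) (rho : 'rV[R]_d -> 'rV[R]_d -> R)
    (mu a b : K) (n : nat) (X : 'M[R]_(n, d)) (y : 'rV[K]_n) (x : 'rV[R]_d) :
  cond_mean iota rho (a * mu + b) X (a *: y + const_mx b) x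
  = a * cond_mean iota rho mu X y x + b.
Proof.
rewrite /cond_mean.
have -> : a *: y + const_mx b - const_mx (a * mu + b) = a *: (y - const_mx mu).
  by apply/rowP => i; rewrite !mxE mulrBr opprD addrACA subrr addr0.
by rewrite -!scalemxAl [in X in _ + X]mxE mulrDr addrAC.
Qed.

Lemma sqrt_cond_var_scale (R : realType) (K : rcfType)
    (iota : {rmorphism R -> K}) (d : nat) (rho : 'rV[R]_d -> 'rV[R]_d -> R)
    (s2 a : K) (n : nat) (X : 'M[R]_(n, d)) (x : 'rV[R]_d) : 0 < a ->
  Num.sqrt (cond_var iota rho (a ^+ 2 * s2) X x)
  = a * Num.sqrt (cond_var iota rho s2 X x).
Proof.
by move=> a_gt0; rewrite /cond_var -mulrA sqrtrM ?sqr_ge0 // sqrtr_sqr gtr0_norm.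
Qed.

Lemma bigmin_affine (K : realFieldType) (I : Type) (r : seq I) (a b y0 : K)
    (y : I -> K) : 0 < a ->
  \big[Num.min/a * y0 + b]_(i <- r) (a * y i + b)
  = a * \big[Num.min/y0]_(i <- r) y i + b.
Proof.
move=> a_gt0; pose g t := a * t + b.
(* [g] is increasing, hence commutes with [Num.min]. The starting value [y0] is not neutral for the
   minimum, so it is transported to [g y0] as well. *)
rewrite -[RHS]/(g _) (big_morph g (id1 := g y0) (op1 := Num.min)) // => s t.
by rewrite /g minr_pMr ?ltW // addr_minl.
Qed.

Lemma aspiration_affine (R : realType) (K : rcfType) (d : nat)
    (M : P_model R K d) (a b : K) (n : nat) (X : 'M[R]_(n.+1, d))
    (y : 'rV[K]_n.+1) : 0 < a ->
  var_est M X (a *: y + const_mx b) = a ^+ 2 * var_est M X y ->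
  aspiration M X (a *: y + const_mx b) = a * aspiration M X y + b.
Proof.
move=> a_gt0 var_y; rewrite /aspiration var_y sqrtrM ?sqr_ge0 // sqrtr_sqr.
(* [mxE] exposes the starting value of the minimum here; the values under the binder are treated on
   the next line. *)
rewrite gtr0_norm // !mxE.
under eq_bigr => i _ do rewrite !mxE.
by rewrite bigmin_affine // mulrBr mulrCA addrAC.
Qed.

(** The degenerate case is preserved too: [a * s] vanishes exactly when [s] does, and the comparison
    of [m] with [yo] that selects the infinite value is unchanged since [a] is positive. *)
Lemma P_ratio_affine (K : rcfType) (m s yo a b : K) : 0 < a ->
  P_ratio (a * m + b) (a * s) (a * yo + b) = P_ratio m s yo.
Proof.
move=> a_gt0; have a_neq0 : a != 0 by rewrite gt_eqF.
rewrite /P_ratio mulf_eq0 (negbTE a_neq0) /= lerD2r ler_pM2l //.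
by rewrite opprD addrACA subrr addr0 -mulrBr -mulf_div divff // mul1r.
Qed.

(** Stated between functions rather than pointwise, so that it can be rewritten inside [argmax] and
    under [tie_break]. *)
Lemma P_criterion_affine (R : realType) (K : rcfType)
    (iota : {rmorphism R -> K}) (d : nat) (M : P_model R K d) (a b : K)
    (n : nat) (X : 'M[R]_(n.+1, d)) (y : 'rV[K]_n.+1) : 0 < a ->
  mean_est M X (a *: y + const_mx b) = a * mean_est M X y + b ->
  var_est M X (a *: y + const_mx b) = a ^+ 2 * var_est M X y ->
  P_criterion iota M X (a *: y + const_mx b) = P_criterion iota M X y.
Proof.
move=> a_gt0 mean_y var_y; apply/funext => x; rewrite /P_criterion.
rewrite aspiration_affine // mean_y var_y cond_mean_affine.
by rewrite sqrt_cond_var_scale // P_ratio_affine.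
Qed.

(** [phi] is tied to [f] only on the hyperrectangle, so the affine relation between observed values
    requires every generated point to lie there. *)
Lemma P_generated_in {R : realType} {K : rcfType}
    {iota : {rmorphism R -> K}} {d : nat} {A : set 'rV[R]_d}
    {M : P_model R K d} {n0 : nat} {F : 'rV[R]_d -> K}
    {x : nat -> 'rV[R]_d} :
  P_generated iota A M n0 F x -> forall i, A (x i).
Proof.
move=> [init step] i; case: (leqP i n0) => [/init //|].
by case: i => // i /step [[]].
Qed.

Lemma first_points_eq {R : realType} {d : nat} {x v : nat -> 'rV[R]_d}
    {n : nat} : (forall i, (i < n)%N -> x i = v i) ->
  first_points x n = first_points v n.
Proof. by move=> xv; apply/row_matrixP => i; rewrite !rowK xv. Qed.

Lemma first_values_eq {R : realType} {K : rcfType} {d : nat}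
    (F : 'rV[R]_d -> K) {x v : nat -> 'rV[R]_d} {n : nat} :
  (forall i, (i < n)%N -> x i = v i) ->
  first_values F x n = first_values F v n.
Proof. by move=> xv; apply/rowP => i; rewrite !mxE xv. Qed.

Theorem theorem1 (R : realType) (K : rcfType) (iota : {rmorphism R -> K})
    (d : nat) (lo hi : 'rV[R]_d)
    (hA : forall j, lo 0 j <= hi 0 j)
    (M : P_model R K d)
    (hrho : is_correlation (hyperrectangle lo hi) (rho M))
    (hvar : forall (n : nat) (X : 'M[R]_(n.+1, d)) (y : 'rV[K]_n.+1),
        0 <= var_est M X y)
    (f : 'rV[R]_d -> R) (phi : 'rV[R]_d -> K) (a b : K)
    (ha : 0 < a)
    (hphi : forall z, hyperrectangle lo hi z -> phi z = a * iota (f z) + b)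
    (n0 : nat) (x v : nat -> 'rV[R]_d)
    (hx : P_generated iota (hyperrectangle lo hi) M n0 (fun z => iota (f z)) x)
    (hv : P_generated iota (hyperrectangle lo hi) M n0 phi v)
    (hinit : forall i, (i <= n0)%N -> x i = v i)
    (hmean_est : forall n, (n0 <= n)%N ->
        mean_est M (first_points x n.+1) (first_values phi x n.+1)
        = a * mean_est M (first_points x n.+1)
                (first_values (fun z => iota (f z)) x n.+1) + b)
    (hvar_est : forall n, (n0 <= n)%N ->
        var_est M (first_points x n.+1) (first_values phi x n.+1)
        = a ^+ 2 * var_est M (first_points x n.+1)
                     (first_values (fun z => iota (f z)) x n.+1)) :
  forall i, x i = v i.
Proof.
have x_in := P_generated_in hx.
have values n : first_values phi x n
    = a *: first_values (fun z => iota (f z)) x n + const_mx b.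
  by apply/rowP => i; rewrite !mxE hphi.
(* Strong induction, because a new point depends on all the earlier ones. *)
elim/ltn_ind => i IH; case: (leqP i n0) => [/hinit //|].
case: i IH => // n IH n0n.
have [_ ->] := hx.2 n n0n; have [_ ->] := hv.2 n n0n.
(* The data along [v] are replaced by those along [x], where the assumptions on the estimates are
   stated. *)
rewrite -(first_points_eq IH) -(first_values_eq phi IH) values.
by rewrite P_criterion_affine // -values ?hmean_est ?hvar_est.
Qed.
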